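(* Let $\mathcal{G}(V,E)$ be any directed graph with source $\texttt{r}\in V$, $|V|=n$, $|E|=m$, operating in the mini-slot model described in the context, and let $\lambda^*$ be its broadcast capacity. Then the dynamic policy $\pi^*$ (described in the context) is throughput-optimal: for every arrival rate $\lambda<\lambda^*$ packets per slot, $\pi^*$ is a broadcast policy of rate $\lambda$.
   Context: Network model: $\mathcal{G}(V,E)$ is a directed graph with $n$ nodes and $m$ edges, each edge of capacity one packet per transmission; external packets arrive only at the source node $\texttt{r}$. Mini-slot model: time is divided into mini-slots; a slot consists of $m$ consecutive mini-slots. At each mini-slot $t$ exactly one edge $S(t)\in E$ is activated, where $\{S(t)\}$ is i.i.d. with $\mathbb{P}(S(t)=e)=1/m$ for all $e\in E$; only the active edge $e=(a,b)$ may carry a packet, and it carries at most one packet (a copy of a packet currently held by $a$) from $a$ to $b$ in that mini-slot. External arrivals at $\texttt{r}$ are i.i.d. across mini-slots with mean $\lambda/m$ packets per mini-slot (i.e. $\lambda$ per slot). A policy in the class $\Pi$ observes the active edge each mini-slot and forwards at most one packet held by $a$ to $b$ (policies may use arbitrary past and future information). Let $R_i^\pi(T)$ be the number of distinct packets received by node $i$ up to slot $T$. A policy $\pi$ is a broadcast policy of rate $\lambda$ if, when packets arrive at $\texttt{r}$ at rate $\lambda$ per slot, $\min_{i\in V}\liminf_{T\to\infty} R_i^\pi(T)/T=\lambda$ in probability. The broadcast capacity $\lambda^*$ is the supremum of all $\lambda$ for which some broadcast policy of rate $\lambda$ in $\Pi$ exists. Reachable sets: a set $F\subseteq V$ is reachable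 if the subgraph induced by $F$ (vertices $F$, edges of $E$ with both endpoints in $F$) contains a directed arborescence rooted at $\texttt{r}$ spanning $F$. For a reachable set $F$, $\partial^+F=\{(a,b)\in E: a\in F, b\notin F\}$, and for $e=(a,b)\in\partial^+F$, $F+e=F\cup\{b\}$. For each reachable $F\subsetneq V$, $Q_F(t)$ denotes the number of packets that at mini-slot $t$ are held by exactly the set of nodes $F$ (a ''class-$F$ packet''); packets held by all nodes are delivered and are counted as $Q_V:=0$. Policy $\pi^*$: at each mini-slot $t$, observe $\mathbf{Q}(t)=(Q_F(t))_F$ and the active edge $S(t)=e=(i,j)$. Consider all reachable sets $F$ with $e\in\partial^+F$ and their weights $w_{F,e}(t)=Q_F(t)-Q_{F+e}(t)$. If some such weight is positive, transmit over $e$ (from $i$ to $j$) a class-$F$ packet for a set $F$ achieving the maximum weight; otherwise idle. *)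

(* Defs.v *)
From HB Require Import structures.
From mathcomp Require Import all_boot all_order all_algebra.
From mathcomp Require Import all_classical all_reals all_analysis.

Set Implicit Arguments.
Unset Strict Implicit.
Unset Printing Implicit Defensive.

Import Order.TTheory GRing.Theory Num.Theory.
Import numFieldNormedType.Exports.

Local Open Scope classical_set_scope.
Local Open Scope ring_scope.

(* The directed graph G(V, E) is a finite type V of nodes with an edge set
   E : {set V * V}; the pair (a, b) is the edge from a to b. *)
Section Graph.
Variables (V : finType) (E : {set V * V}) (r : V).

Definition edges_within (F : {set V}) : {set V * V} :=
  [set e in E | (e.1 \in F) && (e.2 \in F)]%SET.

(* An arborescence rooted at r and spanning F: there is exactly one directed
   walk from r to each node of F (for r itself, the empty walk).  The sequence
   p lists the nodes of the walk after r. *)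
Definition arborescence (B : {set V * V}) (F : {set V}) : Prop :=
  [/\ r \in F,
      (forall e, e \in B -> (e.1 \in F) && (e.2 \in F)) &
      forall v, v \in F ->
        exists! p : seq V, path (fun x y => (x, y) \in B) r p /\ last r p = v].

Definition reachable (F : {set V}) : Prop :=
  exists2 B : {set V * V}, B \subset edges_within F & arborescence B F.

Definition out_boundary (F : {set V}) : {set V * V} :=
  [set e in E | (e.1 \in F) && (e.2 \notin F)]%SET.

End Graph.

(* Dynamics along one sample path: a t is the number of external arrivals in
   mini-slot t, s t the active edge, and u t the packet forwarded over s t
   (None when idling).  Packets are numbered 0, 1, 2, ... in order of arrival;
   those arriving during mini-slot t are held by r from mini-slot t.+1 on, and
   a packet forwarded during mini-slot t is held by the head of s t from
   mini-slot t.+1 on. *)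
Section Dynamics.
Variables (V : finType) (E : {set V * V}) (r : V).
Variables (a : nat -> nat) (s : nat -> V * V) (u : nat -> option nat).

Definition arrived (t : nat) : nat := (\sum_(i < t) a i)%N.

Fixpoint holders (t p : nat) : {set V} :=
  if t is t'.+1 then
    (holders t' p
     :|: (if (p < arrived t)%N then [set r]%SET else finset.set0)
     :|: (if u t' == Some p then [set (s t').2]%SET else finset.set0))%SET
  else finset.set0.

Definition class_size (F : {set V}) (t : nat) : nat :=
  if F == finset.setT then 0%N
  else #|[set p : 'I_(arrived t) | holders t p == F]%SET|.

Definition received (i : V) (T : nat) : nat :=
  let t := (#|E| * T)%N in
  #|[set p : 'I_(arrived t) | i \in holders t p]%SET|.

Definition feasible : Prop :=
  forall t p, u t = Some p -> (s t).1 \in holders t p.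

Definition weight (F : {set V}) (e : V * V) (t : nat) : int :=
  (class_size F t)%:Z - (class_size (e.2 |: F)%SET t)%:Z.

Definition eligible (e : V * V) (F : {set V}) : Prop :=
  reachable E r F /\ e \in out_boundary E F.

(* Ties between classes, and the choice of a packet within the selected class,
   are left unconstrained. *)
Definition max_weight_rule : Prop :=
  forall t,
    match u t with
    | Some p =>
        [/\ (p < arrived t)%N,
            eligible (s t) (holders t p),
            0 < weight (holders t p) (s t) t &
            forall F, eligible (s t) F ->
              weight F (s t) t <= weight (holders t p) (s t) t]
    | None => forall F, eligible (s t) F -> weight F (s t) t <= 0
    end.

End Dynamics.

Section Probability.
Context {d : measure_display} {Omega : measurableType d} {R : realType}.
Variable P : probability Omega R.

(* Random variables with values in a countable type carrying its discrete
   sigma-algebra. *)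
Definition discrete_rv (U : Type) (X : Omega -> U) : Prop :=
  forall B : set U, measurable (X @^-1` B).

Definition iid (U : Type) (X : nat -> Omega -> U) : Prop :=
  [/\ (forall t, discrete_rv (X t)),
      (forall t t' B, P (X t @^-1` B) = P (X t' @^-1` B)) &
      forall (J : seq nat) (B : nat -> set U), uniq J ->
        (P (\bigcap_(t in [set` J]) X t @^-1` B t)
         = \prod_(t <- J) P (X t @^-1` B t))%E].

(* The limit inferior in probability of a sequence of random variables: the
   supremum of the b such that P(X_n < b) tends to 0. *)
Definition liminf_in_probability (X : nat -> Omega -> R) : \bar R :=
  ereal_sup [set b%:E | b in
    [set b : R | P [set w | X n w < b] @[n --> \oo] --> 0%E]].

End Probability.

Section MiniSlotModel.
Context {d : measure_display} {Omega : measurableType d} {R : realType}.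
Variable P : probability Omega R.
Variables (V : finType) (E : {set V * V}) (r : V) (lambda : R).
Variables (A : nat -> Omega -> nat) (S : nat -> Omega -> V * V).

Definition mini_slot_model : Prop :=
  [/\ iid P A,
      (forall t, ('E_P[fun w => (A t w)%:R])%E = (lambda / #|E|%:R)%:E),
      iid P S,
      (forall t w, S t w \in E) &
      forall t e, e \in E -> P (S t @^-1` [set e]) = (1 / #|E|%:R)%:E].

(* A policy is its decision process: U t w is the packet forwarded over the
   active edge in mini-slot t.  Since it may depend on the whole outcome w, no
   restriction is put on the past or future information it uses. *)
Variable U : nat -> Omega -> option nat.

Definition policy_class : Prop :=
  (forall t, discrete_rv (U t)) /\
  (forall w, feasible r (A ^~ w) (S ^~ w) (U ^~ w)).

Definition broadcast_policy : Prop :=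
  policy_class /\
  \big[Order.min/+oo%E]_(i : V)
     liminf_in_probability P
       (fun T w => (received E r (A ^~ w) (S ^~ w) (U ^~ w) i T)%:R / T%:R)
  = lambda%:E.

Definition pi_star : Prop :=
  (forall t, discrete_rv (U t)) /\
  (forall w, max_weight_rule E r (A ^~ w) (S ^~ w) (U ^~ w)).

End MiniSlotModel.

(* The arrival law is determined by lambda only through its mean, so it ranges,
   like the policy, over all possibilities. *)
Definition broadcast_capacity (R : realType) (V : finType) (E : {set V * V})
    (r : V) : \bar R :=
  ereal_sup [set lambda%:E | lambda in [set lambda : R |
    exists (d : measure_display) (Omega : measurableType d)
      (P : probability Omega R) (A : nat -> Omega -> nat)
      (S : nat -> Omega -> V * V) (U : nat -> Omega -> option nat),
      mini_slot_model P E lambda A S /\ broadcast_policy P E r lambda A S U]].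

(* Main.v *)
Require Import Defs.
From HB Require Import structures.
From mathcomp Require Import all_boot all_order all_algebra.
From mathcomp Require Import all_classical all_reals all_analysis.
From mathcomp Require Import measurable_realfun.
From mathcomp Require Import zify ring lra.

(* A fully delivered packet is handed over along edges e_1, ..., e_k that grow
   its set of holders from {r} to V, so Q_{r} is at most the sum of the weights
   w_(e_i), where w_e is the largest (Q_F - Q_(F+e))^+.  Summing over the packets
   delivered by a policy of rate lambda', and using that each edge is activated
   about once per slot, gives lambda' Q_{r} <= sum_e w_e for every vector Q: the
   existence of the policy yields directly what is usually obtained from Edmonds'
   arborescence packing theorem.  For lambda < lambda' this says that, to first
   order, the max-weight rule does not increase sum_F Q_F^2 over a block of L
   mini-slots; the error is O(L^2), as long as the arrivals and the activations
   in the block are close to their means.  After K blocks of length L the queues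
   are therefore O(sqrt K * L), that is O(1 / sqrt K) per mini-slot.  The weak law
   of large numbers makes all K blocks typical with probability tending to 1. *)

Set Implicit Arguments.
Unset Strict Implicit.
Unset Printing Implicit Defensive.

Import Order.TTheory GRing.Theory Num.Theory.
Import numFieldNormedType.Exports.
Local Open Scope classical_set_scope.
Local Open Scope ring_scope.

(** * Reachable sets grow along boundary edges *)

Section ReachableSets.
Variables (V : finType) (E : {set V * V}) (r : V).

Lemma reachable_root : reachable E r [set r]%SET.
Proof.
exists finset.set0; first exact: finset.sub0set.
split => [|e|v]; rewrite ?inE //.
move=> /eqP ->; exists [::]; split => // p [+ _].
by case: p => //= y p; rewrite inE.
Qed.

(** The new edge hangs a leaf on the arborescence: nothing leaves the new node, so walks to old
    nodes are unchanged and remain unique. *)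
Lemma reachable_extend (F : {set V}) e :
  reachable E r F -> e \in out_boundary E F -> reachable E r (e.2 |: F)%SET.
Proof.
case: e => x y [B BF [rF Bin tree]]; rewrite inE /= => /and3P[eE xF yF].
(* Such a walk is peeled from its end: its last edge ends in [F], hence is not the new edge, hence
   lies in [B] and starts in [F] again. *)
have pathB p : path (fun x' y' => (x', y') \in ((x, y) |: B)%SET) r p ->
    last r p \in F -> path (fun x' y' => (x', y') \in B) r p.
  elim/last_ind: p => // p z IH; rewrite !rcons_path last_rcons.
  case/andP=> pp; rewrite !inE xpair_eqE => /orP[/andP[_ /eqP ->]|zB] zF.
    by rewrite zF in yF.
  by rewrite zB andbT IH //; case/andP: (Bin _ zB).
exists ((x, y) |: B)%SET.
  apply/fintype.subsetP => -[x' y']; rewrite !inE xpair_eqE => /orP[/andP[/eqP-> /eqP->]|eB].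
    by rewrite eE xF eqxx orbT.
  have := fintype.subsetP BF _ eB; rewrite inE /= => /and3P[-> -> ->].
  by rewrite !orbT.
split; first by rewrite !inE rF orbT.
- move=> [x' y']; rewrite !inE xpair_eqE /= => /orP[/andP[/eqP-> /eqP->]|eB].
    by rewrite xF eqxx orbT.
  by have /andP[/= -> ->] := Bin _ eB; rewrite !orbT.
have mono p : path (fun x' y' => (x', y') \in B) r p ->
    path (fun x' y' => (x', y') \in ((x, y) |: B)%SET) r p.
  by apply: sub_path => a b; rewrite /= !inE => ->; rewrite orbT.
move=> v; rewrite !inE => /orP[/eqP->|vF]; last first.
  have [p [[pp lp] up]] := tree v vF.
  exists p; split; first by split=> //; exact: mono.
  by move=> q [pq lq]; apply: up; split => //; apply: pathB; rewrite ?lq.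
(* For the new node [y], the last edge of a walk must be [(x, y)], as every edge of [B] ends in
   [F]. *)
have [p [[pp lp] up]] := tree x xF.
exists (rcons p y); split.
  split; last by rewrite last_rcons.
  by rewrite rcons_path lp !inE eqxx andbT mono.
move=> q [+ +]; case/lastP: q => [_ /= ry|q z].
  by rewrite -ry rF in yF.
rewrite rcons_path last_rcons => /andP[pq + zy].
rewrite {}zy !inE xpair_eqE => /orP[/andP[/eqP lq _]|yB]; last first.
  by case/andP: (Bin _ yB); rewrite /= (negbTE yF).
by rewrite (up q) //; split => //; apply: pathB => //; rewrite lq.
Qed.

End ReachableSets.

(** * Evolution of holder sets along one sample path *)

Section Trajectories.
Variables (V : finType) (E : {set V * V}) (r : V).
Variables (a : nat -> nat) (s : nat -> V * V) (u : nat -> option nat).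

Local Notation arr := (arrived a).
Local Notation H := (holders r a s u).

Lemma arrivedS t : arr t.+1 = (arr t + a t)%N.
Proof. by rewrite /arrived big_ord_recr. Qed.

Lemma arrived_mono t t' : (t <= t')%N -> (arr t <= arr t')%N.
Proof.
move=> /subnKC <-; elim: (t' - t)%N => [|k IH]; first by rewrite addn0.
by rewrite addnS arrivedS (leq_trans IH) // leq_addr.
Qed.

Lemma holders_mono t t' p : (t <= t')%N -> H t p \subset H t' p.
Proof.
move=> /subnKC <-; elim: (t' - t)%N => [|k IH]; first by rewrite addn0.
by rewrite addnS (fintype.subset_trans IH) //= -finset.setUA finset.subsetUl.
Qed.

Lemma root_in_holders t p : (p < arr t)%N -> r \in H t p.
Proof.
case: t => [|t] /= pt; first by rewrite /arrived big_ord0 in pt.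
by rewrite pt !inE eqxx !orbT.
Qed.

Hypothesis feas : feasible r a s u.

(** A feasible policy forwards only what the tail of the edge holds, so a packet gets its first
    holder by arriving at [r]. *)
Lemma holders_unarrived t p : (arr t <= p)%N -> H t p = finset.set0.
Proof.
elim: t => // t IH pt /=.
have h0 : H t p = finset.set0.
  by apply: IH; apply: leq_trans pt; exact: arrived_mono.
rewrite h0 ltnNge pt /=; case: eqP => [up|_]; last by rewrite !finset.setU0.
by have := feas up; rewrite h0 inE.
Qed.

Lemma holders_step t p : (p < arr t)%N ->
  H t.+1 p = (if u t == Some p then (s t).2 |: H t p else H t p)%SET.
Proof.
move=> pt /=; have rp := root_in_holders pt.
have -> : (p < arr t.+1)%N by rewrite (leq_trans pt) // arrived_mono.
have -> : (H t p :|: [set r] = H t p)%SET.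
  by apply/finset.setUidPl; rewrite finset.sub1set.
by case: ifP => _; rewrite ?finset.setU0 // finset.setUC.
Qed.

Lemma holders_new t p : (arr t <= p < arr t.+1)%N -> H t.+1 p = [set r]%SET.
Proof.
case/andP=> tp pt /=; rewrite pt (holders_unarrived tp) finset.set0U.
case: eqP => [up|_]; last by rewrite finset.setU0.
by have := feas up; rewrite (holders_unarrived tp) inE.
Qed.

End Trajectories.

Local Arguments holders : simpl never.

(** * The price of delivering packets *)

Section DeliveryCost.
Context {R : realDomainType}.
Variables (V : finType) (E : {set V * V}) (r : V).
Variables (a : nat -> nat) (s : nat -> V * V) (u : nat -> option nat).
Variables (q : {set V} -> R) (W : V * V -> R).
Hypothesis feas : feasible r a s u.
Hypothesis sE : forall t, s t \in E.
Hypothesis W_ge0 : forall e, 0 <= W e.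
Hypothesis qW : forall F e, eligible E r e F -> q F <= q (e.2 |: F)%SET + W e.

Local Notation H := (holders r a s u).

(** A telescoping sum: the holder set starts as [{r}] and changes only when [p] itself is forwarded,
    at which point [q] drops by at most [W] of the active edge. Forwarding to a node that already
    holds [p] costs nothing and is covered by [W_ge0]. *)
Lemma delivery_cost t p : (p < arrived a t)%N ->
  reachable E r (H t p) /\
  q [set r]%SET <= q (H t p) + \sum_(i < t | u i == Some p) W (s i).
Proof.
elim: t => [|t IH] pt; first by rewrite /arrived big_ord0 in pt.
have [tp|lt_pt] := leqP (arrived a t) p.
  rewrite (@holders_new _ _ _ _ _ feas) ?tp //.
  split; first exact: reachable_root.
  by rewrite lerDl sumr_ge0.
have [reach {}IH] := IH lt_pt.
rewrite holders_step // big_mkcond big_ord_recr -big_mkcond /=.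
case: eqP => [up|_]; last by rewrite addr0.
have [eF|eF] := boolP ((s t).2 \in H t p).
  rewrite (finset.setUidPr _) ?finset.sub1set // addrA; split => //.
  by rewrite (le_trans IH) // lerDl.
have elig : eligible E r (s t) (H t p).
  by split=> //; rewrite inE sE eF (feas up).
split; first by apply: reachable_extend; case: elig.
by rewrite [_ + W _]addrC addrA (le_trans IH) // lerD2r qW.
Qed.

(** Each mini-slot forwards at most one packet, so the costs of distinct packets are charged to
    distinct mini-slots. *)
Lemma total_delivery_cost t : q finset.setT = 0 ->
  #|[set p : 'I_(arrived a t) | H t p == finset.setT]%SET|%:R * q [set r]%SET
    <= \sum_(i < t) W (s i).
Proof.
move=> qT; rewrite mulr_natl -sumr_const.
apply: (@le_trans _ _ (\sum_(p < arrived a t) \sum_(i < t | u i == Some (val p)) W (s i))).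
  rewrite [leRHS](bigID (mem [set p : 'I_(arrived a t) | H t p == finset.setT]%SET)) /=.
  rewrite -[leLHS]addr0 lerD //; last by apply: sumr_ge0 => p _; exact: sumr_ge0.
  apply: ler_sum => p; rewrite inE => /eqP Hp.
  by have [_] := delivery_cost (ltn_ord p); rewrite Hp qT add0r.
rewrite (exchange_big_dep xpredT) //=; apply: ler_sum => i _.
case: (u i) => [k|]; last by rewrite big_pred0.
have [kt|kt] := ltnP k (arrived a t).
  by rewrite (big_pred1 (Ordinal kt)) // => p; rewrite /= eq_sym.
rewrite big_pred0 // => p; apply/eqP => -[kp].
by rewrite kp leqNgt ltn_ord in kt.
Qed.

End DeliveryCost.

(** * Activation counts of the edges *)

Section Visits.
Context {R : realDomainType}.
Variables (V : finType) (E : {set V * V}) (s : nat -> V * V).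

Definition visits (e : V * V) (t : nat) : nat := (\sum_(i < t) (s i == e))%N.

Lemma sum_visits (W : V * V -> R) t : (forall i, s i \in E) ->
  \sum_(i < t) W (s i) = \sum_(e in E) W e * (visits e t)%:R.
Proof.
move=> sE.
under [RHS]eq_bigr do rewrite /visits natr_sum mulr_sumr.
rewrite exchange_big /=; apply: eq_bigr => i _.
rewrite (bigD1 (s i)) //= eqxx mulr1 big1 ?addr0 // => e /andP[_].
by rewrite eq_sym => /negbTE ->; rewrite mulr0.
Qed.

End Visits.

(** * Queue vectors and linear functionals of them *)

Section ClassSizes.
Context {R : realDomainType}.
Variables (V : finType) (r : V).
Variables (a : nat -> nat) (s : nat -> V * V) (u : nat -> option nat).

Local Notation H := (holders r a s u).
Local Notation arr := (arrived a).

Definition queue (t : nat) (F : {set V}) : R := (class_size r a s u F t)%:R.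

(** For [f] vanishing at [V] this is the scalar product of [f] with the queue vector. Summing over
    packets rather than classes makes its increments explicit. *)
Definition potential (f : {set V} -> R) (t : nat) : R :=
  \sum_(p < arr t) f (H t p).

Lemma queue_ge0 t F : 0 <= queue t F.
Proof. exact: ler0n. Qed.

Lemma queueT t : queue t finset.setT = 0.
Proof. by rewrite /queue /class_size eqxx. Qed.

Lemma queue_potential t F : F != finset.setT ->
  queue t F = potential (fun G => (G == F)%:R) t.
Proof.
move=> /negbTE FT; rewrite /queue /class_size FT /potential -sum1_card natr_sum.
by rewrite big_mkcond /=; apply: eq_bigr => p _; rewrite inE; case: ifP.
Qed.

Lemma potential_queue (f : {set V} -> R) t : f finset.setT = 0 ->
  potential f t = \sum_F f F * queue t F.
Proof.
move=> fT; rewrite (bigD1 finset.setT) //= fT mul0r add0r.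
under eq_bigr => F FT do rewrite queue_potential // mulr_sumr.
rewrite exchange_big /=; apply: eq_bigr => p _.
have [HT|HT] := eqVneq (H t p) finset.setT.
  rewrite HT fT big1 // => F; rewrite eq_sym => /negbTE ->; exact: mulr0.
rewrite (bigD1 (H t p)) //= eqxx mulr1 big1 ?addr0 // => F /andP[_].
by rewrite eq_sym => /negbTE ->; exact: mulr0.
Qed.

Hypothesis feas : feasible r a s u.

Lemma potential_step (f : {set V} -> R) t :
  potential f t.+1 = potential f t + (a t)%:R * f [set r]%SET +
    (if u t is Some p then f ((s t).2 |: H t p)%SET - f (H t p) else 0).
Proof.
rewrite /potential -(big_mkord xpredT (fun p => f (H t.+1 p))).
(* The packets split at [arr t]: the new ones all have class [{r}], and at most one of the old ones
   changes class. *)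
rewrite (@big_cat_nat _ _ _ (arr t)) //=; last exact: arrived_mono.
rewrite [X in _ + X](_ : _ = (a t)%:R * f [set r]%SET); last first.
  rewrite big_nat_cond (eq_bigr (fun=> f [set r]%SET)); last first.
    by move=> p; rewrite andbT => pt; rewrite (holders_new feas pt).
  by rewrite -big_nat_cond sumr_const_nat arrivedS addKn mulr_natl.
rewrite [in RHS]addrAC; congr (_ + _); rewrite big_mkord.
rewrite [LHS](eq_bigr (fun p : 'I_(arr t) =>
    f (if u t == Some (val p) then (s t).2 |: H t p else H t p)%SET)); last first.
  by move=> p _; rewrite holders_step.
case ut : (u t) => [k|]; last by rewrite addr0; apply: eq_bigr.
have kt : (k < arr t)%N.
  rewrite ltnNge; apply/negP => tk.
  by have := feas ut; rewrite (holders_unarrived feas tk) inE.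
rewrite (bigD1 (Ordinal kt)) //= eqxx [X in _ = X + _](bigD1 (Ordinal kt)) //=.
rewrite (eq_bigr (fun p : 'I_(arr t) => f (H t p))); first by ring.
move=> p pk; case: eqP => // -[kp]; case/eqP: pk; exact: val_inj.
Qed.

Lemma queue_step t F : `|queue t.+1 F - queue t F| <= (a t)%:R + 1.
Proof.
have [->|FT] := eqVneq F finset.setT; first by rewrite !queueT subrr normr0 ler_wpDl.
rewrite !queue_potential // potential_step.
rewrite -[potential _ t + _ + _]addrA [potential _ t + _]addrC addrK.
rewrite (le_trans (ler_normD _ _)) // lerD //.
  by rewrite ger0_norm ?mulr_ge0 // ler_piMr //; case: eqP => _; rewrite ?lexx ?ler01.
case: (u t) => [p|]; last by rewrite normr0.
by do 2!case: eqP => _; rewrite ?subrr ?subr0 ?sub0r ?normrN ?normr1 ?normr0.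
Qed.

Lemma queue_variation t j F : `|queue (t + j) F - queue t F| <=
  (arr (t + j))%:R - (arr t)%:R + j%:R.
Proof.
elim: j => [|j IH]; first by rewrite addn0 !subrr normr0 addr0.
rewrite addnS arrivedS natrD -natr1.
have := queue_step (t + j) F; rewrite !ler_norml in IH * => /andP[h1 h2].
by case/andP: IH => h3 h4; apply/andP; split; lra.
Qed.

End ClassSizes.

(** * The largest positive weight of an edge *)

Section MaxPressure.
Context {R : realDomainType}.
Variables (V : finType) (E : {set V * V}) (r : V) (f : {set V} -> R).

(** The quantity [w_e] for an arbitrary real vector [f]; starting the maximum at 0 accounts for
    idling. *)
Definition max_pressure (e : V * V) : R :=
  \big[Num.max/0]_(F : {set V} | `[< eligible E r e F >]) (f F - f (e.2 |: F)%SET).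

Lemma max_pressure_ge0 e : 0 <= max_pressure e.
Proof. exact: bigmax_ge_id. Qed.

Lemma max_pressure_ge e F : eligible E r e F ->
  f F - f (e.2 |: F)%SET <= max_pressure e.
Proof.
move=> /asboolP eF.
by apply: (@le_bigmax_cond _ _ _ _ _ _ (fun F => f F - f (e.2 |: F)%SET)).
Qed.

Lemma max_pressure_le e x : 0 <= x ->
  (forall F, eligible E r e F -> f F - f (e.2 |: F)%SET <= x) -> max_pressure e <= x.
Proof. by move=> x0 h; apply/bigmax_leP; split => // F /asboolP; exact: h. Qed.

End MaxPressure.

(** * Quadratic drift under the max-weight rule *)

Section MaxWeight.
Variables (V : finType) (E : {set V * V}) (r : V).
Variables (a : nat -> nat) (s : nat -> V * V) (u : nat -> option nat).
Hypothesis rule : max_weight_rule E r a s u.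

Lemma max_weight_feasible : feasible r a s u.
Proof.
move=> t p ut; have := rule t; rewrite ut => -[_ [_ +] _ _].
by rewrite inE => /and3P[].
Qed.

End MaxWeight.

Section Drift.
Context {R : realFieldType}.
Variables (V : finType) (E : {set V * V}) (r : V).
Variables (a : nat -> nat) (s : nat -> V * V) (u : nat -> option nat).
Hypothesis rule : max_weight_rule E r a s u.
Hypothesis sE : forall t, s t \in E.

Local Notation arr := (arrived a).
Local Notation Q := (@queue R V r a s u).
Local Notation Phi := (@potential R V r a s u).
Local Notation H := (holders r a s u).

Lemma weightE F e t : (weight r a s u F e t)%:~R = Q t F - Q t (e.2 |: F)%SET.
Proof. by rewrite /weight intrB. Qed.

(* The rule maximises the weights at time [t], which differ by at most [2 D]
   from the weights given by [f]; this is paid twice. *)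
Lemma max_weight_gain (f : {set V} -> R) (D : R) t :
  (forall F, `|Q t F - f F| <= D) ->
  (if u t is Some p then f ((s t).2 |: H t p)%SET - f (H t p) else 0) <=
    4 * D - max_pressure E r f (s t).
Proof.
move=> near; have D0 : 0 <= D by rewrite (le_trans _ (near [set r]%SET)).
have bnd F : f F <= Q t F + D /\ Q t F <= f F + D.
  by move: (near F); rewrite ler_norml => /andP[]; split; lra.
rewrite lerBrDr -lerBrDl; have := rule t.
case: (u t) => [p [_ elig wpos wmax]|wneg].
  have wpos' : 0 < Q t (H t p) - Q t ((s t).2 |: H t p)%SET.
    by rewrite -weightE ltr0z.
  have [? ?] := bnd (H t p); have [? ?] := bnd ((s t).2 |: H t p)%SET.
  apply: max_pressure_le; first by lra.
  move=> F /wmax; rewrite -(ler_int R) !weightE => ?.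
  by have [? ?] := bnd F; have [? ?] := bnd ((s t).2 |: F)%SET; lra.
apply: max_pressure_le; first by lra.
move=> F /wneg; rewrite -(ler_int R) weightE => ?.
by have [? ?] := bnd F; have [? ?] := bnd ((s t).2 |: F)%SET; lra.
Qed.

Lemma cross_drift t j (D : R) :
  (arr (t + j))%:R - (arr t)%:R + j%:R <= D ->
  Phi (Q t) (t + j) + \sum_(e in E) max_pressure E r (Q t) e * (visits s e (t + j))%:R
  <= Phi (Q t) t + \sum_(e in E) max_pressure E r (Q t) e * (visits s e t)%:R
     + ((arr (t + j))%:R - (arr t)%:R) * Q t [set r]%SET + j%:R * (4 * D).
Proof.
rewrite -!(sum_visits _ _ sE).
elim: j => [|j IH] hD; first by rewrite addn0 subrr !mul0r !addr0.
have hj : (arr (t + j))%:R - (arr t)%:R + j%:R <= D.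
  apply: le_trans hD; rewrite -natr1 addnS arrivedS natrD.
  by have := ler0n R (a (t + j)%N); lra.
have feas := max_weight_feasible rule.
have := @max_weight_gain (Q t) D (t + j)%N _.
move/(_ (fun F => le_trans (queue_variation feas t j F) hj)) => gain.
have {hj} := IH hj.
rewrite addnS (potential_step feas) big_ord_recr /= arrivedS natrD -[j.+1%:R]natr1.
move: gain; set g := (if _ is Some p then _ else _).
move: g (\sum_(i < t + j) _) (\sum_(i < t) _) (Phi _ _) (Phi _ _).
move=> g x1 x2 y1 y2 gain IH'; nra.
Qed.

Definition lyapunov (t : nat) : R := \sum_F Q t F ^+ 2.

(** Each square is expanded around [Q t F]. With [D = (c1 + 1) * L], the cross term contributes at
    most [2 * L * 4 * D], because the assumption relating [c1] and [c2] cancels its first-order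
    part; the squared increments contribute at most [D ^+ 2] per class. *)
Lemma lyapunov_block t L (c1 c2 : R) : 0 <= c1 ->
  c1 * Q t [set r]%SET <= c2 * \sum_(e in E) max_pressure E r (Q t) e ->
  (arr (t + L))%:R - (arr t)%:R <= c1 * L%:R ->
  (forall e, e \in E -> c2 * L%:R <= (visits s e (t + L))%:R - (visits s e t)%:R) ->
  lyapunov (t + L) <= lyapunov t +
    (8 * (c1 + 1) + #|{set V}|%:R * (c1 + 1) ^+ 2) * L%:R ^+ 2.
Proof.
move=> c10 hcap harr hvis.
have feas := max_weight_feasible rule.
have L0 : 0 <= L%:R :> R by [].
have hD : (arr (t + L))%:R - (arr t)%:R + L%:R <= (c1 + 1) * L%:R by lra.
have -> : lyapunov (t + L) = lyapunov t
    + 2 * (Phi (Q t) (t + L) - Phi (Q t) t) + \sum_F (Q (t + L) F - Q t F) ^+ 2.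
  rewrite !potential_queue ?queueT // -sumrB mulr_sumr -!big_split /=.
  by apply: eq_bigr => F _; ring.
have sq : \sum_F (Q (t + L) F - Q t F) ^+ 2 <= #|{set V}|%:R * ((c1 + 1) * L%:R) ^+ 2.
  rewrite mulr_natl -sumr_const; apply: ler_sum => F _.
  rewrite -[leLHS]real_normK ?num_real // lerXn2r ?nnegrE //.
    by rewrite mulr_ge0 // addr_ge0.
  exact: le_trans (queue_variation feas t L F) hD.
have cross := cross_drift hD.
have visW : L%:R * (c2 * \sum_(e in E) max_pressure E r (Q t) e) <=
    \sum_(e in E) max_pressure E r (Q t) e * (visits s e (t + L))%:R -
    \sum_(e in E) max_pressure E r (Q t) e * (visits s e t)%:R.
  rewrite -sumrB !mulr_sumr; apply: ler_sum => e eE.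
  rewrite -mulrBr mulrA [L%:R * _]mulrC [leLHS]mulrC ler_wpM2l ?hvis //.
  exact: max_pressure_ge0.
have h1 : ((arr (t + L))%:R - (arr t)%:R) * Q t [set r]%SET <= L%:R * (c1 * Q t [set r]%SET).
  by rewrite mulrA [L%:R * _]mulrC ler_wpM2r ?queue_ge0.
have h2 : L%:R * (c1 * Q t [set r]%SET) <= L%:R * (c2 * \sum_(e in E) max_pressure E r (Q t) e).
  by rewrite ler_wpM2l.
move: sq cross; rewrite exprMn; lra.
Qed.

Lemma lyapunov_blocks K L (c1 c2 : R) : 0 <= c1 ->
  (forall f : {set V} -> R, (forall F, 0 <= f F) -> f finset.setT = 0 ->
     c1 * f [set r]%SET <= c2 * \sum_(e in E) max_pressure E r f e) ->
  (forall k, (k < K)%N ->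
     (arr (k.+1 * L))%:R - (arr (k * L))%:R <= c1 * L%:R) ->
  (forall k e, (k < K)%N -> e \in E ->
     c2 * L%:R <= (visits s e (k.+1 * L))%:R - (visits s e (k * L))%:R) ->
  lyapunov (K * L) <=
    K%:R * ((8 * (c1 + 1) + #|{set V}|%:R * (c1 + 1) ^+ 2) * L%:R ^+ 2).
Proof.
move=> c10 hcap harr hvis.
elim: K harr hvis => [|K IH] harr hvis.
  rewrite !mul0r /lyapunov big1 // => F _.
  have [->|FT] := eqVneq F finset.setT; first by rewrite queueT expr2 mul0r.
  by rewrite queue_potential // /potential /arrived mul0n !big_ord0 expr2 mul0r.
have {}IH := IH (fun k kK => harr k (ltnW kK)) (fun k e kK => hvis k e (ltnW kK)).
rewrite mulSnr -natr1 mulrDl mul1r (le_trans _ (lerD IH (lexx _))) //.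
apply: (@lyapunov_block _ _ _ c2) => //.
- by apply: hcap => [F|]; [exact: queue_ge0|exact: queueT].
- by rewrite -mulSnr; exact: harr.
- by move=> e eE; rewrite -mulSnr; exact: hvis.
Qed.

(** A packet missing at [i] is undelivered and is therefore counted in some queue. *)
Lemma undelivered_queue i t : (arr t)%:R - \sum_F Q t F <=
  #|[set p : 'I_(arr t) | i \in H t p]%SET|%:R.
Proof.
have h : Phi (fun F => (F != finset.setT)%:R) t <= \sum_F Q t F.
  rewrite potential_queue ?eqxx //; apply: ler_sum => F _.
  by case: (_ != _); rewrite ?mul1r // mul0r queue_ge0.
rewrite lerBlDr (le_trans _ (lerD (lexx _) h)) // -[X in X%:R <= _]card_ord.
rewrite -!sum1_card !natr_sum [X in _ <= X + _]big_mkcond /= -big_split /=.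
apply: ler_sum => p _; rewrite inE.
have [->|_] := eqVneq (H t p) finset.setT; first by rewrite inE addr0.
by case: ifP => _ /=; lra.
Qed.

End Drift.

(** * Measurability for countable-valued variables *)

Section DiscreteRandomVariables.
Context {d : measure_display} {Omega : measurableType d}.

Lemma discrete_rv_comp (U U' : Type) (X : Omega -> U) (g : U -> U') :
  discrete_rv X -> discrete_rv (fun w => g (X w)).
Proof. by move=> mX B; exact: (mX (g @^-1` B)). Qed.

(** The preimage is a countable union over the values of the first component, enumerated by
    [unpickle]. *)
Lemma discrete_rv_pair (U : countType) (U' : Type) (X : Omega -> U) (X' : Omega -> U') :
  discrete_rv X -> discrete_rv X' -> discrete_rv (fun w => (X w, X' w)).
Proof.
move=> mX mX' B.
rewrite (_ : _ @^-1` B = \bigcup_n (if unpickle n is Some x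
   then X @^-1` [set x] `&` X' @^-1` [set y | B (x, y)] else set0)).
  apply: bigcupT_measurable => n; case: (unpickle n) => [x|//].
  by apply: measurableI; [exact: mX|exact: mX'].
apply/seteqP; split => [w Bw|w [n _]] /=.
  by exists (pickle (X w)) => //; rewrite pickleK.
by case: (unpickle n) => [x [/= <-]|].
Qed.

Lemma discrete_rv_prefix (U : countType) (Z : nat -> Omega -> U) n :
  (forall t, discrete_rv (Z t)) -> discrete_rv (fun w => mkseq (Z ^~ w) n).
Proof.
move=> mZ; elim: n => [|n IH] B.
  rewrite (_ : _ @^-1` B = if `[< B [::] >] then setT else set0).
    by case: ifP.
  by apply/seteqP; split => w /=; case: asboolP.
under eq_fun do rewrite mkseqS.
exact: (discrete_rv_comp (fun x => rcons x.1 x.2) (discrete_rv_pair IH (mZ n))).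
Qed.

(** An event decided by the first [n] values is saturated for the prefix map, hence equals the
    preimage of its image. *)
Lemma measurable_prefix (U : countType) (Z : nat -> Omega -> U) n (D : set Omega) :
  (forall t, discrete_rv (Z t)) ->
  (forall w w', (forall t, (t < n)%N -> Z t w = Z t w') -> D w -> D w') ->
  measurable D.
Proof.
move=> mZ DZ; pose f w := mkseq (Z ^~ w) n.
rewrite (_ : D = f @^-1` (f @` D)); first exact: discrete_rv_prefix.
apply/seteqP; split => [w Dw|w [w' Dw' ff]]; first by exists w.
apply: DZ Dw' => t tn.
by rewrite -(nth_mkseq (Z 0%N w) (Z ^~ w') tn) -/(f w') ff nth_mkseq.
Qed.

End DiscreteRandomVariables.

(** * Events of vanishing probability *)

Section Vanishing.
Context {d : measure_display} {Omega : measurableType d} {R : realType}.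
Variable P : probability Omega R.

Definition vanishing (D : nat -> set Omega) : Prop :=
  (forall n, measurable (D n)) /\
  forall e : R, 0 < e -> exists n0, forall n, (n0 <= n)%N -> (P (D n) <= e%:E)%E.

Lemma vanishing_cvg D : vanishing D -> P (D n) @[n --> \oo] --> 0%E.
Proof.
move=> [mD vD].
have fD n : P (D n) \is a fin_num by apply: fin_num_measure.
apply/fine_cvgP; split; first by apply: nearW.
apply/cvgrPdist_le => e e0; have [n0 hn0] := vD e e0.
exists n0 => // n /= /hn0 h.
by rewrite sub0r normrN ger0_norm ?fine_ge0 // -lee_fin fineK.
Qed.

Lemma cvg_vanishing D : (forall n, measurable (D n)) ->
  P (D n) @[n --> \oo] --> 0%E -> vanishing D.
Proof.
move=> mD /fine_cvgP[_] /cvgrPdist_le cD; split => // e e0.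
have [n0 _ hn0] := cD e e0; exists n0 => n /hn0 /=.
rewrite sub0r normrN ger0_norm ?fine_ge0 // -lee_fin fineK //.
exact: fin_num_measure.
Qed.

Lemma vanishing_sub D D' n0 : (forall n, measurable (D n)) -> vanishing D' ->
  (forall n, (n0 <= n)%N -> D n `<=` D' n) -> vanishing D.
Proof.
move=> mD [mD' vD'] DD'; split => // e /vD'[n1 hn1].
exists (maxn n0 n1) => n; rewrite geq_max => /andP[n0n n1n].
apply: le_trans (hn1 _ n1n); apply: le_measure; rewrite ?inE //.
exact: DD'.
Qed.

Lemma vanishing_comp D (phi : nat -> nat) : vanishing D ->
  (forall m, exists n0, forall n, (n0 <= n)%N -> (m <= phi n)%N) ->
  vanishing (fun n => D (phi n)).
Proof.
move=> [mD vD] hphi; split => // e /vD[n1 hn1].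
by have [n0 hn0] := hphi n1; exists n0 => n /hn0 /hn1.
Qed.

Lemma vanishingU D D' : vanishing D -> vanishing D' ->
  vanishing (fun n => D n `|` D' n).
Proof.
move=> [mD vD] [mD' vD']; split => [n|e e0]; first exact: measurableU.
have e2 : 0 < e / 2 by rewrite divr_gt0.
have [n1 h1] := vD _ e2; have [n2 h2] := vD' _ e2.
exists (maxn n1 n2) => n; rewrite geq_max => /andP[n1n n2n].
rewrite (le_trans (measureU2 _ _ _)) // [e in leRHS]splitr EFinD leeD //.
  exact: h1.
exact: h2.
Qed.

Lemma vanishing_exists (I : finType) (D : I -> nat -> set Omega) :
  (forall i, vanishing (D i)) -> vanishing (fun n => [set w | exists i, D i n w]).
Proof.
move=> vD.
have -> : (fun n => [set w | exists i, D i n w]) =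
    (fun n => \big[setU/set0]_(i <- enum I) D i n).
  apply/funext => n; rewrite -bigcup_seq; apply/seteqP; split => w [i].
    by exists i => //=; rewrite mem_enum.
  by move=> _ Di; exists i.
elim: (enum I) => [|i s IH].
  rewrite (_ : (fun _ => _) = fun=> set0); last by apply/funext => n; rewrite big_nil.
  by split => [//|e e0]; exists 0%N => n _; rewrite measure0 lee_fin ltW.
rewrite (_ : (fun _ => _) = fun n => D i n `|` \big[setU/set0]_(j <- s) D j n).
  exact: vanishingU.
by apply/funext => n; rewrite big_cons.
Qed.

(** An event of probability at most 1/2 is not the whole space. This extracts one typical sample
    path, on which deterministic arguments can run. *)
Lemma vanishing_complement D : vanishing D -> exists n0, forall n, (n0 <= n)%N ->
  exists w, ~ D n w.
Proof.
move=> [mD vD]; have [n0 h] := vD (1 / 2) ltac:(lra).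
exists n0 => n /h hn; apply: contrapT => /forallNP all.
move: hn; rewrite (_ : D n = setT) ?probability_setT; last first.
  by apply/seteqP; split => w // _; apply: contrapT.
by rewrite lee_fin; lra.
Qed.

End Vanishing.

(** * Weak law for the frequency of an event, by Chebyshev *)

Section WeakLaw.
Context {d : measure_display} {Omega : measurableType d} {R : realType}.
Variable P : probability Omega R.

Lemma markov_ge0 (g : Omega -> R) (c : R) : 0 <= c -> measurable_fun setT g ->
  (forall w, 0 <= g w) ->
  (c%:E * P [set w | (c <= g w)%R] <= \int[P]_w (g w)%:E)%E.
Proof.
move=> c0 mg g0; set D := [set w | _].
have mD : measurable D.
  rewrite -[D]setTI; exact: measurable_fun_le.
rewrite -[X in P X](setIT D) -integral_indic // -ge0_integralZl //; last first.
  by apply/measurable_EFinP; exact: measurable_indic.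
apply: ge0_le_integral => //.
- by move=> w _; rewrite -EFinM lee_fin mulr_ge0.
- apply/measurable_EFinP; exact: measurable_funM.
- exact/measurable_EFinP.
move=> w _; rewrite -EFinM lee_fin indicE.
by have [|] := boolP (w \in D); rewrite ?mulr0 // mulr1 inE.
Qed.

Variables (U : Type) (X : nat -> Omega -> U).
Hypothesis iidX : iid P X.

Lemma measurable_iid i B : measurable (X i @^-1` B).
Proof. by case: iidX => mX _ _; exact: mX. Qed.

Definition frequency (B : set U) : R := fine (P (X 0 @^-1` B)).

Lemma iid_frequency i B : P (X i @^-1` B) = (frequency B)%:E.
Proof.
case: iidX => mX /(_ i 0%N B) -> _; rewrite fineK //.
by apply: fin_num_measure; exact: mX.
Qed.

Lemma iid_frequencyM i j B : i != j ->
  P (X i @^-1` B `&` X j @^-1` B) = (frequency B * frequency B)%:E.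
Proof.
move=> ij; case: iidX => _ _ /(_ [:: i; j] (fun=> B)).
rewrite /= inE ij => /(_ erefl); rewrite !big_cons big_nil mule1 !iid_frequency.
rewrite EFinM => <-; congr (P _); apply/seteqP; split => [w [Xi Xj] k /=|w h].
  by rewrite !inE => /orP[/eqP->|/eqP->].
by split; apply: h; rewrite /= !inE eqxx ?orbT.
Qed.

Lemma frequency_ge0 B : 0 <= frequency B.
Proof. exact: fine_ge0. Qed.

Lemma frequency_le1 B : frequency B <= 1.
Proof. by rewrite -lee_fin -(iid_frequency 0) probability_le1 //; exact: measurable_iid. Qed.

Definition hits (B : set U) n w : R := \sum_(i < n) \1_(X i @^-1` B) w.

Lemma hits_ge0 B n w : 0 <= hits B n w.
Proof. exact: sumr_ge0. Qed.

Lemma measurable_hits B n : measurable_fun setT (hits B n).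
Proof.
apply: measurable_sum => i; apply: measurable_indic; exact: measurable_iid.
Qed.

Lemma integral_hits B n : (\int[P]_w (hits B n w)%:E)%E = (n%:R * frequency B)%:E.
Proof.
under eq_integral do rewrite /hits -sumEFin.
rewrite ge0_integral_sum //; last first.
  move=> i; apply/measurable_EFinP/measurable_indic; exact: measurable_iid.
rewrite (eq_bigr (fun=> (frequency B)%:E)); last first.
  move=> i _; rewrite integral_indic //; last exact: measurable_iid.
  by rewrite setIT; exact: iid_frequency.
by rewrite sumEFin sumr_const card_ord mulr_natl.
Qed.

(** In the expanded square, an off-diagonal pair contributes the squared frequency by independence,
    and a diagonal pair the frequency itself. *)
Lemma integral_hits2 B n : (\int[P]_w (hits B n w ^+ 2)%:E)%E =
  (n%:R * (n%:R * frequency B ^+ 2 + (frequency B - frequency B ^+ 2)))%:E.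
Proof.
under eq_integral => w _.
  rewrite expr2 /hits mulr_suml -sumEFin.
  under eq_bigr => i _.
    rewrite mulr_sumr -sumEFin.
    under eq_bigr => j _ do rewrite -[(_ * _)%R]/((\1_(X i @^-1` B) \* \1_(X j @^-1` B)) w) -indicI.
    over.
  over.
have mI i j : measurable (X i @^-1` B `&` X j @^-1` B).
  by apply: measurableI; exact: measurable_iid.
rewrite ge0_integral_sum //; last 2 first.
  move=> i; apply: emeasurable_sum => j; apply/measurable_EFinP/measurable_indic; exact: mI.
  by move=> i w _; apply: sume_ge0 => j _; rewrite lee_fin.
rewrite (eq_bigr (fun=> (n%:R * frequency B ^+ 2 + (frequency B - frequency B ^+ 2))%:E)).
  by rewrite sumEFin sumr_const card_ord -[X in X%:E = _]mulr_natl.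
move=> i _; rewrite ge0_integral_sum //; last first.
  by move=> j; apply/measurable_EFinP/measurable_indic; exact: mI.
rewrite (eq_bigr (fun j : 'I_n => (frequency B ^+ 2 +
   (if j == i then frequency B - frequency B ^+ 2 else 0))%:E)).
  rewrite sumEFin big_split /= sumr_const card_ord.
  by rewrite -[X in (X + _)%:E = _]mulr_natl -big_mkcond big_pred1_eq.
move=> j _; rewrite integral_indic ?setIT //.
have [->|ji] := eqVneq j i.
  by rewrite setIid addrC subrK; exact: iid_frequency.
by rewrite addr0; apply: iid_frequencyM; rewrite eq_sym.
Qed.

Lemma variance_hits B n :
  (\int[P]_w ((hits B n w - n%:R * frequency B) ^+ 2)%:E <= n%:R%:E)%E.
Proof.
set c := n%:R * _; have c0 : 0 <= c by rewrite mulr_ge0 // frequency_ge0.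
have mh := measurable_hits B n.
have mcE : measurable_fun setT (fun w => ((hits B n w - c) ^+ 2)%:E).
  by apply/measurable_EFinP; apply: measurable_funX; exact: measurable_funB.
(* The cross term stands on the left so that all four integrands are nonnegative and additivity
   applies. *)
have sum : (\int[P]_w ((hits B n w - c) ^+ 2)%:E + \int[P]_w ((2 * c)%:E * (hits B n w)%:E)
    = \int[P]_w (hits B n w ^+ 2)%:E + \int[P]_w (cst (c ^+ 2)%:E w))%E.
  rewrite -!ge0_integralD //.
  - by apply: eq_integral => w _; rewrite -EFinM -!EFinD; congr EFin; rewrite /=; ring.
  - by move=> w _; rewrite lee_fin sqr_ge0.
  - by apply/measurable_EFinP; apply: measurable_funX.
  - by move=> w _; rewrite lee_fin sqr_ge0.
  - by move=> w _; rewrite lee_fin sqr_ge0.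
  - by move=> w _; rewrite -EFinM lee_fin; apply: mulr_ge0; [exact: mulr_ge0|exact: hits_ge0].
  - by under eq_fun do rewrite -EFinM; apply/measurable_EFinP; exact: measurable_funM.
move: sum; rewrite ge0_integralZl //; last 3 first.
  exact/measurable_EFinP.
  by move=> w _; rewrite lee_fin hits_ge0.
  by rewrite lee_fin mulr_ge0.
have -> : (\int[P]_w (cst (c ^+ 2)%:E w) = (c ^+ 2)%:E)%E.
  by rewrite integral_cst // -[RHS]mule1; congr (_ * _)%E; exact: probability_setT.
rewrite integral_hits integral_hits2.
rewrite -EFinM -EFinD => sum.
rewrite -[leLHS](@addeK _ (2 * c * (n%:R * frequency B))%:E) // sum -EFinB lee_fin.
have := frequency_ge0 B; have := frequency_le1 B.
have : 0 <= n%:R :> R by [].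
by rewrite /c; nra.
Qed.

Lemma weak_law_hits B (e : R) : 0 < e ->
  vanishing P (fun n => [set w | e * n%:R <= `|hits B n w - n%:R * frequency B|]).
Proof.
move=> e0; split => [n|x x0].
  rewrite -[X in measurable X]setTI; apply: measurable_fun_le => //.
  apply: measurableT_comp => //; apply: measurable_funB => //; exact: measurable_hits.
(* Chebyshev bounds the probability by [n / (e * n) ^+ 2], which is at most [x] once [n] exceeds
   [e ^- 2 / x]. *)
exists (Num.truncn (e ^- 2 / x)).+1 => n n0.
have n_gt0 : 0 < n%:R :> R by rewrite ltr0n (leq_trans _ n0).
have en : 0 < (e * n%:R) ^+ 2 by rewrite exprn_gt0 // mulr_gt0.
have mN : measurable_fun setT (fun w => (hits B n w - n%:R * frequency B) ^+ 2).
  by apply: measurable_funX; apply: measurable_funB => //; exact: measurable_hits.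
have := markov_ge0 (ltW en) mN (fun w => sqr_ge0 _).
move=> /le_trans /(_ (variance_hits B n)).
rewrite (_ : [set w | _] = [set w | e * n%:R <= `|hits B n w - n%:R * frequency B|]); last first.
  apply: eq_set => w; rewrite -(real_normK (num_real (hits B n w - _))).
  by rewrite ler_pXn2r // ?nnegrE // ltW // mulr_gt0.
rewrite muleC -lee_pdivlMr // => /le_trans; apply.
rewrite -EFinM lee_fin exprMn ler_pdivrMr ?mulr_gt0 ?exprn_gt0 //.
have h : e ^- 2 / x <= n%:R.
  by rewrite ltW // (lt_le_trans (truncnS_gt _)) // ler_nat.
move: h; rewrite ler_pdivrMr // -(ler_pM2l (exprn_gt0 2 e0)) mulfV ?gt_eqF ?exprn_gt0 // => h.
rewrite (_ : _ * _ = n%:R * (e ^+ 2 * (n%:R * x))); last by ring.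
by rewrite -[leLHS]mulr1 ler_pM2l.
Qed.

End WeakLaw.

(** * Weak law for integrable arrivals, by truncation *)

Section WeakLawMean.
Context {d : measure_display} {Omega : measurableType d} {R : realType}.
Variable P : probability Omega R.
Variables (X : nat -> Omega -> nat) (mean : R).
Hypothesis iidX : iid P X.
Hypothesis meanX : forall i, ('E_P[fun w => (X i w)%:R])%E = mean%:E.

Lemma measurable_natr (g : nat -> nat) i :
  measurable_fun setT (fun w => (g (X i w))%:R : R).
Proof.
move=> _ B _; rewrite setTI.
exact: (measurable_iid iidX i ((fun x => (g x)%:R) @^-1` B)).
Qed.

(** The layer-cake formula: a truncated variable is a finite sum of indicators, each covered by
    [weak_law_hits]. *)
Lemma minn_sum M x : minn x M = (\sum_(k < M) (k < x))%N.
Proof.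
elim: M => [|M IH]; first by rewrite big_ord0 minn0.
by rewrite big_ord_recr /= -IH; lia.
Qed.

Lemma integral_minn i M :
  (\int[P]_w (minn (X i w) M)%:R%:E)%E = (\sum_(k < M) frequency P X [set x | (k < x)%N])%:E.
Proof.
under eq_integral => w _ do rewrite minn_sum natr_sum -sumEFin.
rewrite ge0_integral_sum //; last first.
  by move=> k; apply/measurable_EFinP; exact: (measurable_natr (fun x => (k < x)%N)).
rewrite -sumEFin; apply: eq_bigr => k _.
rewrite -(iid_frequency iidX i) -[X in P X]setIT -integral_indic //.
  by apply: eq_integral => w _; rewrite indicE mem_setE.
exact: (measurable_iid iidX).
Qed.

Lemma integral_subn i M : (\int[P]_w (X i w - M)%:R%:E)%E =
  (mean - \sum_(k < M) frequency P X [set x | (k < x)%N])%:E.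
Proof.
have := meanX i; rewrite unlock.
rewrite (_ : (fun w => _) = (fun w => (minn (X i w) M)%:R%:E + (X i w - M)%:R%:E)%E); last first.
  by apply/funext => w; rewrite -EFinD -natrD; congr (_%:R%:E); lia.
rewrite ge0_integralD //; first last.
- by apply/measurable_EFinP; exact: (measurable_natr (subn^~ M)).
- by apply/measurable_EFinP; exact: (measurable_natr (minn^~ M)).
rewrite integral_minn => h.
by rewrite EFinB -h [(_ + \int[P]_x _)%E]addeC addeK.
Qed.

(** Monotone convergence of [minn X M] to [X], which stays constant once [M] reaches the value of
    [X]. *)
Lemma truncated_mean_cvg (e : R) : 0 < e -> exists M,
  mean - e <= \sum_(k < M) frequency P X [set x | (k < x)%N].
Proof.
move=> e0.
have : (\int[P]_w (minn (X 0 w) M)%:R%:E)%E @[M --> \oo] --> mean%:E.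
  rewrite -(meanX 0) unlock.
  rewrite [X in _ --> X](_ : _ = \int[P]_w
      (limn ((fun M => (minn (X 0 w) M)%:R%:E) : (\bar R)^nat)))%E.
    apply: cvg_monotone_convergence => //.
    - by move=> M; apply/measurable_EFinP; exact: (measurable_natr (minn^~ M)).
    - by move=> w _ M M' MM'; rewrite lee_fin ler_nat; lia.
  apply: eq_integral => w _; apply/esym/cvg_lim => //.
  apply: cvg_near_cst; exists (X 0 w) => // M /= hM.
  by congr (_%:R%:E); lia.
under eq_fun do rewrite integral_minn.
move=> /fine_cvgP[_] /cvgrPdist_le /(_ e e0)[M _] /(_ M (leqnn M)) /=.
by rewrite ler_norml => /andP[_ h]; exists M; lra.
Qed.

Lemma truncated_mean_le M : \sum_(k < M) frequency P X [set x | (k < x)%N] <= mean.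
Proof.
rewrite -subr_ge0 -lee_fin -(integral_subn 0) integral_ge0 // => w _.
Qed.

Lemma sum_hits_gt n M w :
  \sum_(k < M) hits X [set x | (k < x)%N] n w = \sum_(i < n) (minn (X i w) M)%:R :> R.
Proof.
rewrite /hits exchange_big /=; apply: eq_bigr => i _.
by rewrite minn_sum natr_sum; apply: eq_bigr => k _; rewrite indicE mem_setE.
Qed.

(** Only a finite mean is assumed. The variables are cut at a level [M]: the lower part is a finite
    sum of indicators, and the total excess [C] has small expectation, so Markov's inequality
    controls it. *)
Lemma weak_law_mean (e : R) : 0 < e ->
  vanishing P (fun n => [set w | e * n%:R <= `|(\sum_(i < n) X i w)%:R - n%:R * mean|]).
Proof.
move=> e0.
have mD n : measurable [set w | e * n%:R <= `|(\sum_(i < n) X i w)%:R - n%:R * mean|].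
  apply: (measurable_prefix (Z := X) (n := n)); first by case: iidX.
  by move=> w w' XX /=; rewrite (eq_bigr (fun i : 'I_n => X i w')) // => i _; exact: XX.
split => // x x0.
(* The first bound limits the bias of the truncated mean; the second makes Markov's bound
   [eta / (e / 4)] for [C] at most [x / 2]. *)
pose eta := Num.min (e / 4) (x * e / 8).
have eta0 : 0 < eta by rewrite lt_min !divr_gt0 // mulr_gt0.
have [eta1 eta2] : eta <= e / 4 /\ eta <= x * e / 8.
  by rewrite !ge_min !lexx orbT.
have [M hM] := truncated_mean_cvg eta0; have hM' := truncated_mean_le M.
(* The [M] indicator deviations then add up to at most [e / 4] per step; the successor covers
   [M = 0]. *)
pose b := e / (4 * M.+1%:R).
have b0 : 0 < b by rewrite divr_gt0 // mulr_gt0.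
have bM : M%:R * b <= e / 4.
  have -> : M%:R * b = e / 4 * (M%:R / M.+1%:R).
    by rewrite /b invfM; ring.
  by rewrite ler_piMr ?divr_ge0 // ?ltW // ltr_pdivrMr // mul1r ltr_nat.
have [mB /(_ (x / 2)) []] := vanishing_exists (fun k : 'I_M =>
   weak_law_hits iidX [set x | (k < x)%N] b0); first by rewrite divr_gt0.
move=> n0 hn0; exists n0.+1 => n n0n.
have n_gt0 : 0 < n%:R :> R by rewrite ltr0n (leq_trans _ n0n).
pose C w : R := \sum_(i < n) (X i w - M)%:R.
have mC : measurable_fun setT C.
  by apply: measurable_sum => i; exact: (measurable_natr (subn^~ M)).
have mC' : measurable [set w | e / 4 * n%:R <= C w].
  by rewrite -[X in measurable X]setTI; exact: measurable_fun_le.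
have PC : (P [set w | (e / 4 * n%:R <= C w)%R] <= (x / 2)%:E)%E.
  have c0 : 0 < e / 4 * n%:R by rewrite mulr_gt0 // divr_gt0.
  have := markov_ge0 P (ltW c0) mC (fun w => sumr_ge0 _ (fun i _ => ler0n _ _)).
  have -> : (\int[P]_w (C w)%:E)%E =
      (n%:R * (mean - \sum_(k < M) frequency P X [set x | (k < x)%N]))%:E.
    under eq_integral do rewrite /C -sumEFin.
    rewrite ge0_integral_sum //; last first.
      by move=> i; apply/measurable_EFinP; exact: (measurable_natr (subn^~ M)).
    rewrite (eq_bigr (fun=> (mean - \sum_(k < M) frequency P X [set x | (k < x)%N])%:E)).
      by rewrite sumEFin sumr_const card_ord -[X in X%:E = _]mulr_natl.
    by move=> i _; rewrite integral_subn.
  rewrite muleC -lee_pdivlMr // => /le_trans; apply.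
  rewrite -EFinM lee_fin ler_pdivrMr // mulrCA mulrA.
  rewrite [leRHS]mulrC ler_pM2l //; lra.
apply: (@le_trans _ _ (x / 2 + x / 2)%:E); last by rewrite -splitr.
apply: le_trans (leeD (hn0 _ (ltnW n0n)) PC).
apply: le_trans (measureU2 _ _ _) => //.
apply: le_measure; rewrite ?inE //; first exact: measurableU.
(* Outside the exceptional events, the indicator deviations, the truncation bias and the excess are
   each at most [e / 4 * n]. *)
move=> w /= ew; apply: contrapT => /not_orP[/forallNP hk /negP]; rewrite -ltNge => hC.
have hk1 : `|\sum_(k < M) (hits X [set x | (k < x)%N] n w
     - n%:R * frequency P X [set x | (k < x)%N])| <= M%:R * b * n%:R.
  rewrite [leRHS](_ : _ = \sum_(k < M) b * n%:R); last first.
    by rewrite sumr_const card_ord -mulrA mulr_natl.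
  apply: le_trans (ler_norm_sum _ _ _) _.
  by apply: ler_sum => k _; rewrite ltW // ltNge; apply/negP/hk.
move: hk1; rewrite sumrB sum_hits_gt -mulr_sumr => hk1.
have hS : (\sum_(i < n) X i w)%:R = \sum_(i < n) (minn (X i w) M)%:R + C w.
  rewrite -big_split natr_sum; apply: eq_bigr => i _ /=.
  by rewrite -natrD minnE subnK // leq_subr.
have C0 : 0 <= C w by apply: sumr_ge0.
have h1 : M%:R * b * n%:R <= e / 4 * n%:R by rewrite ler_pM2r.
have h2 : n%:R * (mean - \sum_(k < M) frequency P X [set x | (k < x)%N]) <= n%:R * (e / 4).
  by rewrite ler_pM2l //; lra.
have h3 : 0 <= n%:R * (mean - \sum_(k < M) frequency P X [set x | (k < x)%N]).
  by rewrite mulr_ge0 // subr_ge0.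
have h4 : 0 < e * n%:R by rewrite mulr_gt0.
move: ew; rewrite hS leNgt ltr_norml => /negP; apply.
move: hk1; rewrite ler_norml => /andP[h5 h6].
by apply/andP; split; lra.
Qed.

End WeakLawMean.

(** * Counting delivered packets; increments over blocks *)

Lemma natr_card_set (R : pzSemiRingType) (T : finType) (b : pred T) :
  #|[set p | b p]%SET|%:R = \sum_p (b p)%:R :> R.
Proof.
rewrite -sum1_card natr_sum big_mkcond /=; apply: eq_bigr => p _.
by rewrite inE; case: (b p).
Qed.

(** A union bound: an undelivered packet is missing at some node. *)
Lemma delivered_ge (R : realDomainType) (V : finType) n (h : 'I_n -> {set V}) :
  n%:R - \sum_i (n%:R - #|[set p | i \in h p]%SET|%:R) <=
    #|[set p | h p == finset.setT]%SET|%:R :> R.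
Proof.
have nE : n%:R = \sum_(p < n) 1 :> R by rewrite sumr_const card_ord.
rewrite {}nE natr_card_set.
rewrite [X in _ - X](eq_bigr (fun i => \sum_(p < n) (1 - (i \in h p)%:R))); last first.
  by move=> i _; rewrite natr_card_set -sumrB.
rewrite exchange_big -sumrB /=; apply: ler_sum => p _.
have pos i : 0 <= 1 - (i \in h p)%:R :> R by case: (i \in h p); rewrite ?subrr ?subr0.
have [_|] := eqVneq (h p) finset.setT; first by rewrite gerBl sumr_ge0.
rewrite -finset.subTset => /fintype.subsetPn[i _ /negbTE ip].
by rewrite (bigD1 i) //= ip subr0 opprD addrA subrr sub0r oppr_le0 sumr_ge0.
Qed.

(** The deviation is at most [e * K * l] at both ends of a block; [x 0 = 0] supplies the left end of
    the first block. The factor [K] is harmless when [e] is chosen after [K]. *)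
Lemma block_increment (R : realFieldType) (x : nat -> R) K (l c e : R) :
  0 <= l -> 0 <= e -> x 0%N = 0 ->
  (forall k, (k < K)%N -> `|x k.+1 - k.+1%:R * l * c| <= e * (k.+1%:R * l)) ->
  forall k, (k < K)%N -> `|x k.+1 - x k - c * l| <= 2 * K%:R * e * l.
Proof.
move=> l0 e0 x0 hx k kK.
have bnd j : (j <= K)%N -> `|x j - j%:R * l * c| <= e * (K%:R * l).
  case: j => [_|j jK]; first by rewrite x0 !mul0r subr0 normr0 !mulr_ge0.
  apply: le_trans (hx j jK) _.
  by rewrite ler_wpM2l // ler_wpM2r // ler_nat.
have := bnd _ kK; have := bnd _ (ltnW kK).
rewrite !ler_norml -[k.+1%:R]natr1 => /andP[h1 h2] /andP[h3 h4].
by apply/andP; split; lra.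
Qed.

(** * Measurability of events about received packets *)

Section PrefixDependence.
Variables (V : finType) (E : {set V * V}) (r : V).
Variables (a a' : nat -> nat) (s s' : nat -> V * V) (u u' : nat -> option nat).

Lemma arrived_ext n : (forall t, (t < n)%N -> a t = a' t) ->
  arrived a n = arrived a' n.
Proof. by move=> h; apply: eq_bigr => i _; exact: h. Qed.

Lemma holders_ext n p :
  (forall t, (t < n)%N -> (a t, s t, u t) = (a' t, s' t, u' t)) ->
  holders r a s u n p = holders r a' s' u' n p.
Proof.
elim: n => // n IH h; have [an sn un] := h n (ltnSn n).
rewrite /holders -/(holders _ _ _ _ _ _) -/(holders _ _ _ _ _ _) IH.
  by rewrite sn un (@arrived_ext n.+1) // => t /h[].
by move=> t tn; apply: h; exact: ltnW.
Qed.

Lemma received_ext i T :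
  (forall t, (t < #|E| * T)%N -> (a t, s t, u t) = (a' t, s' t, u' t)) ->
  received E r a s u i T = received E r a' s' u' i T.
Proof.
move=> h; rewrite /received -(@arrived_ext (#|E| * T)%N); last by move=> t /h[].
by apply: eq_card => p; rewrite !inE (holders_ext _ h).
Qed.

End PrefixDependence.

Section ReceivedEvents.
Context {d : measure_display} {Omega : measurableType d}.
Variables (V : finType) (E : {set V * V}) (r : V).
Variables (A : nat -> Omega -> nat) (S : nat -> Omega -> V * V).
Variable (U : nat -> Omega -> option nat).
Hypothesis mA : forall t, discrete_rv (A t).
Hypothesis mS : forall t, discrete_rv (S t).
Hypothesis mU : forall t, discrete_rv (U t).

Lemma measurable_received i T (Q : nat -> Prop) :
  measurable [set w | Q (received E r (A ^~ w) (S ^~ w) (U ^~ w) i T)].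
Proof.
apply: (measurable_prefix (Z := fun t w => (A t w, S t w, U t w)) (n := (#|E| * T)%N)).
  by move=> t; apply: discrete_rv_pair => //; exact: discrete_rv_pair.
by move=> w w' h /=; rewrite (received_ext r i h).
Qed.

End ReceivedEvents.

Lemma received_mono (V : finType) (r : V) a s u i t t' : (t <= t')%N ->
  (#|[set p : 'I_(arrived a t) | i \in holders r a s u t p]%SET| <=
   #|[set p : 'I_(arrived a t') | i \in holders r a s u t' p]%SET|)%N.
Proof.
move=> tt'; have aa := arrived_mono a tt'.
have inj : injective (widen_ord aa) by move=> p q /(congr1 val) /= /val_inj.
rewrite -(card_imset _ inj); apply: subset_leq_card.
apply/fintype.subsetP => q /imsetP[p]; rewrite !inE => ip ->.
exact: (fintype.subsetP (holders_mono _ _ _ _ _ tt')).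
Qed.

Lemma received_le_arrived (V : finType) (E : {set V * V}) (r : V) a s u i T :
  (received E r a s u i T <= arrived a (#|E| * T))%N.
Proof. by rewrite (leq_trans (max_card _)) // card_ord. Qed.

(** * Deterministic guarantee for max-weight on a typical path *)

Section MaxWeightReceived.
Context {R : realFieldType}.
Variables (V : finType) (E : {set V * V}) (r : V).
Variables (a : nat -> nat) (s : nat -> V * V) (u : nat -> option nat).
Hypothesis rule : max_weight_rule E r a s u.
Hypothesis sE : forall t, s t \in E.

(** The square of each queue is at most the Lyapunov function, so the choice of [K] bounds each
    queue by [kappa * K * L], a small share of the elapsed time. *)
Lemma max_weight_received i t K L (c1 c2 kappa : R) : 0 <= c1 -> 0 <= kappa ->
  (forall f : {set V} -> R, (forall F, 0 <= f F) -> f finset.setT = 0 ->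
     c1 * f [set r]%SET <= c2 * \sum_(e in E) max_pressure E r f e) ->
  (forall k, (k < K)%N ->
     (arrived a (k.+1 * L))%:R - (arrived a (k * L))%:R <= c1 * L%:R) ->
  (forall k e, (k < K)%N -> e \in E ->
     c2 * L%:R <= (visits s e (k.+1 * L))%:R - (visits s e (k * L))%:R) ->
  8 * (c1 + 1) + #|{set V}|%:R * (c1 + 1) ^+ 2 <= kappa ^+ 2 * K%:R ->
  (K * L <= t)%N ->
  (arrived a (K * L))%:R - #|{set V}|%:R * (kappa * (K * L)%:R) <=
    #|[set p : 'I_(arrived a t) | i \in holders r a s u t p]%SET|%:R.
Proof.
move=> c10 k0 hcap harr hvis hK hL.
apply: (@le_trans _ _
  #|[set p : 'I_(arrived a (K * L)) | i \in holders r a s u (K * L) p]%SET|%:R); last first.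
  by rewrite ler_nat received_mono.
have := undelivered_queue (R := R) r a s u i (K * L); apply: le_trans; rewrite lerD2l lerN2.
have lyap := lyapunov_blocks rule sE c10 hcap harr hvis.
rewrite mulr_natl -sumr_const; apply: ler_sum => F _.
rewrite -(ler_pXn2r (n := 2)) ?nnegrE ?queue_ge0 ?mulr_ge0 //.
apply: le_trans (_ : lyapunov r a s u (K * L) <= _).
  by rewrite /lyapunov (bigD1 F) //= lerDl sumr_ge0 // => G _; exact: sqr_ge0.
apply: le_trans lyap _.
rewrite natrM !exprMn mulrA mulrA ler_wpM2r ?sqr_ge0 // [K%:R ^+ 2]expr2 mulrA mulrC.
by rewrite ler_wpM2r.
Qed.

End MaxWeightReceived.

(** * From typical sample paths to rates *)

Section Model.
Context {d : measure_display} {Omega : measurableType d} {R : realType}.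
Variable P : probability Omega R.
Variables (V : finType) (E : {set V * V}) (r : V) (lambda : R).
Variables (A : nat -> Omega -> nat) (S : nat -> Omega -> V * V).
Variable U : nat -> Omega -> option nat.
Hypothesis model : mini_slot_model P E lambda A S.
Hypothesis mU : forall t, discrete_rv (U t).

Local Notation rec w := (received E r (A ^~ w) (S ^~ w) (U ^~ w)).

(** A probability space has a sample point, and the edge active there belongs to [E]. *)
Lemma edges_gt0 : (0 < #|E|)%N.
Proof.
have [|n0 /(_ n0 (leqnn _)) [w _]] := @vanishing_complement _ _ _ P (fun=> set0).
  by split => // e e0; exists 0%N => n _; rewrite measure0 lee_fin ltW.
by case: model => _ _ _ /(_ 0%N w) SE _; rewrite card_gt0; apply/set0Pn; exists (S 0 w).
Qed.

Lemma mean_arrivals_ge0 : 0 <= lambda / #|E|%:R.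
Proof.
rewrite -lee_fin; case: model => _ /(_ 0%N) <- _ _ _.
by apply: expectation_ge0 => w.
Qed.

Lemma visits_hits e n w : (visits (S ^~ w) e n)%:R = hits S [set e] n w :> R.
Proof.
rewrite /visits /hits natr_sum; apply: eq_bigr => i _.
rewrite indicE; congr (nat_of_bool _)%:R.
by apply/eqP/idP => [<-|]; rewrite inE.
Qed.

Lemma frequency_edge e : e \in E -> frequency P S [set e] = 1 / #|E|%:R.
Proof.
by case: model => _ _ _ _ /(_ 0%N e) + eE => /(_ eE) h; rewrite /frequency h.
Qed.

Lemma vanishing_arrivals (e : R) : 0 < e ->
  vanishing P (fun n => [set w | e * n%:R <=
    `|(arrived (A ^~ w) n)%:R - n%:R * (lambda / #|E|%:R)|]).
Proof. by case: model => iA mA _ _ _; exact: weak_law_mean. Qed.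

Lemma vanishing_visits (e : R) : 0 < e ->
  vanishing P (fun n => [set w | exists g : {x | x \in E}, e * n%:R <=
    `|(visits (S ^~ w) (val g) n)%:R - n%:R * (1 / #|E|%:R)|]).
Proof.
case: model => _ _ iS _ _ e0; apply: vanishing_exists => -[g gE].
have := weak_law_hits iS [set g] e0; rewrite frequency_edge //.
by under eq_fun do under eq_set do rewrite -visits_hits.
Qed.

Lemma measurable_rec i T (Q : nat -> Prop) : measurable [set w | Q (rec w i T)].
Proof.
by case: model => [[mA _ _] _ [mS _ _] _ _]; exact: measurable_received.
Qed.

Lemma vanishing_liminf i (b : R) :
  (b%:E < liminf_in_probability P (fun T w => ((rec w i T)%:R / T%:R)%R))%E ->
  vanishing P (fun T => [set w | (rec w i T)%:R / T%:R < b]).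
Proof.
move=> /ereal_sup_gt[_ /= [b' cb' <-]]; rewrite lte_fin => bb'.
have mB c T : measurable [set w | (rec w i T)%:R / T%:R < c :> R].
  exact: (measurable_rec i T (fun k => k%:R / T%:R < c)).
apply: (@vanishing_sub _ _ _ _ _ _ 0) (cvg_vanishing _ cb') _ => //.
by move=> T _ w /= h; exact: lt_trans bb'.
Qed.

(** A single typical sample path suffices: there [total_delivery_cost] gives the inequality up to
    errors of order [e]. The conclusion no longer mentions probability, so it can be used for
    another system on the same graph. *)
Lemma capacity_pressure (f : {set V} -> R) :
  broadcast_policy P E r lambda A S U ->
  (forall F, 0 <= f F) -> f finset.setT = 0 ->
  lambda * f [set r]%SET <= \sum_(e in E) max_pressure E r f e.
Proof.
move=> [[_ feas] lim] f0 fT.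
set W := max_pressure E r f; set M := \sum_(e in E) _.
have M0 : 0 <= M by apply: sumr_ge0 => e _; exact: max_pressure_ge0.
(* The coefficient of [e] in the total error, so that [e = x / (c + 1)] keeps the error below
   [x]. *)
pose c : R := M + (2 * #|V|%:R + 1) * f [set r]%SET.
have c0 : 0 <= c by rewrite addr_ge0 // mulr_ge0 // addr_ge0 // mulr_ge0.
suff main (e : R) : 0 < e ->
    (lambda - (2 * #|V|%:R + 1) * e) * f [set r]%SET <= (1 + e) * M.
  apply/ler_addgt0Pr => x x0.
  have e0 : 0 < x / (c + 1) by rewrite divr_gt0 // ltr_wpDl.
  have : x / (c + 1) * c <= x.
    by rewrite mulrAC ler_pdivrMr ?ltr_wpDl // ler_wpM2l ?lerDl // ltW.
  by have := main _ e0; rewrite /c; lra.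
move=> e0; have m0 := edges_gt0.
have mR : 0 < #|E|%:R :> R by rewrite ltr0n.
have em : 0 < e / #|E|%:R by rewrite divr_gt0.
have toinf k : exists n0, forall n, (n0 <= n)%N -> (k <= #|E| * n)%N.
  by exists k => n /leq_trans; apply; rewrite leq_pmull.
have v1 := vanishing_comp (vanishing_arrivals em) toinf.
have v2 := vanishing_comp (vanishing_visits em) toinf.
have v3 : vanishing P (fun T => [set w | exists i, (rec w i T)%:R / T%:R < lambda - e]).
  apply: vanishing_exists => i; apply: vanishing_liminf.
  apply: (@lt_le_trans _ _ lambda%:E); first by rewrite lte_fin ltrBlDr ltrDl.
  by rewrite -lim; exact: bigmin_le_cond.
have [n0 hn0] := vanishing_complement (vanishingU v1 (vanishingU v2 v3)).
have [w] := hn0 n0.+1 (leqnSn _); set T := n0.+1.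
move=> /not_orP[/negP + /not_orP[/forallNP h2 /forallNP h3]].
rewrite -ltNge => h1.
have T0 : 0 < T%:R :> R by [].
have tE : (#|E| * T)%:R = #|E|%:R * T%:R :> R by rewrite natrM.
have mV : #|E|%:R != 0 :> R by rewrite gt_eqF.
rewrite tE in h1.
set t := (#|E| * T)%N in h1 h2.
have sE : forall k, S k w \in E by case: model.
have W0 e' : 0 <= W e' by exact: max_pressure_ge0.
have qW F e' : eligible E r e' F -> f F <= f (e'.2 |: F)%SET + W e'.
  by move=> /(max_pressure_ge f); rewrite lerBlDl.
have cost := total_delivery_cost (feas w) sE W0 qW t fT.
have recge i : (lambda - e) * T%:R <= (rec w i T)%:R.
  by have /negP := h3 i; rewrite -leNgt ler_pdivlMr.
have arrle : (arrived (A ^~ w) t)%:R <= (lambda + e) * T%:R.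
  move: h1; rewrite ltr_norml => /andP[_].
  have -> : e / #|E|%:R * (#|E|%:R * T%:R) = e * T%:R by field.
  have -> : #|E|%:R * T%:R * (lambda / #|E|%:R) = lambda * T%:R by field.
  by lra.
have visle g : g \in E -> (visits (S ^~ w) g t)%:R <= (1 + e) * T%:R.
  move=> gE; have /negP := h2 (exist _ g gE); rewrite -ltNge /= tE ltr_norml => /andP[_].
  have -> : e / #|E|%:R * (#|E|%:R * T%:R) = e * T%:R by field.
  have -> : #|E|%:R * T%:R * (1 / #|E|%:R) = T%:R :> R by field.
  by lra.
have del := delivered_ge R (fun p : 'I_(arrived (A ^~ w) t) =>
  holders r (A ^~ w) (S ^~ w) (U ^~ w) t p).
(* At most [(lambda + e) * T] packets arrive and each node has at least [(lambda - e) * T], so each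
   node misses at most [2 * e * T]; a last [e * T] is lost in the lower bound on arrivals. *)
have del2 : (lambda - (2 * #|V|%:R + 1) * e) * T%:R <=
    #|[set p : 'I_(arrived (A ^~ w) t) |
        holders r (A ^~ w) (S ^~ w) (U ^~ w) t p == finset.setT]%SET|%:R.
  apply: le_trans del.
  have arrge : (lambda - e) * T%:R <= (arrived (A ^~ w) t)%:R.
    by rewrite (le_trans (recge r)) // ler_nat received_le_arrived.
  have : \sum_i ((arrived (A ^~ w) t)%:R - (rec w i T)%:R) <= #|V|%:R * (2 * e * T%:R).
    rewrite mulr_natl -sumr_const; apply: ler_sum => i _.
    by have := recge i; lra.
  by rewrite /received -/t; lra.
rewrite -(ler_pM2r T0) mulrAC.
apply: le_trans (ler_wpM2r (f0 _) del2) _; apply: le_trans cost _.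
rewrite (sum_visits _ _ sE) mulrAC mulr_sumr; apply: ler_sum => g gE.
by rewrite mulrC ler_wpM2r // visle.
Qed.

Lemma max_weight_rate (lambda' : R) i (b : R) : lambda < lambda' ->
  (forall f : {set V} -> R, (forall F, 0 <= f F) -> f finset.setT = 0 ->
     lambda' * f [set r]%SET <= \sum_(e in E) max_pressure E r f e) ->
  (forall w, max_weight_rule E r (A ^~ w) (S ^~ w) (U ^~ w)) ->
  b < lambda ->
  vanishing P (fun T => [set w | (rec w i T)%:R / T%:R < b]).
Proof.
(* In both inequalities [x], [y], [z], [t], [k] stand for [al], [g], [m], [T], [K]; then [l], [e],
   [n] stand for [K * L T], [de'] and the number of arrivals. *)
have arith1 (x y z t k : R) : 2 * x * k <= t * (y * z) -> x * k <= y / 2 * (z * t).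
  by lra.
have arith2 (x y z t k l e n : R) : - (e * l) <= n - l * x -> x * k <= y / 2 * (z * t) ->
    e * l <= y / 4 * (z * t) -> y / 4 * l <= y / 4 * (z * t) ->
    x * (z * t - k) <= x * l -> (x - y) * z * t <= n - y / 4 * l by lra.
move=> ll' hcap rule bl.
have m0 := edges_gt0; have al0 := mean_arrivals_ge0.
set m : R := #|E|%:R in al0 *; set al := lambda / m in al0 *.
have mR : 0 < m by rewrite ltr0n.
have mV : m != 0 by rewrite gt_eqF.
have lE : lambda = al * m by rewrite /al divfK.
have l0 : 0 <= lambda by rewrite lE mulr_ge0 // ltW.
have l'0 : 0 < lambda' by exact: le_lt_trans ll'.
(* The solution of [al + de = (1 / m - de) * lambda']: the gap between the rates tolerates an error
   [de] in both arrivals and activations. *)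
pose de := (lambda' - lambda) / (m * (1 + lambda')).
have de0 : 0 < de by rewrite divr_gt0 ?subr_gt0 // mulr_gt0 // addr_gt0.
pose c1 := al + de; pose c2 := 1 / m - de.
have c10 : 0 <= c1 by rewrite addr_ge0 // ltW.
have c12 : c1 = c2 * lambda'.
  rewrite /c1 /c2 /al /de; field; rewrite mV /= gt_eqF // addr_gt0 //.
have c20 : 0 <= c2 by rewrite -(pmulr_lge0 _ l'0) -c12.
have cap f : (forall F, 0 <= f F) -> f finset.setT = 0 ->
    c1 * f [set r]%SET <= c2 * \sum_(e in E) max_pressure E r f e.
  by move=> f0 fT; rewrite c12 -mulrA ler_wpM2l // hcap.
(* The slack per mini-slot. One quarter goes to the queues, one quarter to the deviation of the
   arrivals, and half to rounding the horizon to whole blocks. *)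
pose g := (lambda - b) / m.
have g0 : 0 < g by rewrite divr_gt0 // subr_gt0.
have bE : b = (al - g) * m by rewrite /al /g; field.
pose h : R := #|{set V}|%:R.
have h0 : 0 < h by rewrite ltr0n; apply/card_gt0P; exists finset.setT.
pose kappa := g / (4 * h).
have kappa0 : 0 < kappa by rewrite divr_gt0 // mulr_gt0.
have hkappa : h * kappa = g / 4 by rewrite /kappa; field; rewrite gt_eqF.
pose C := 8 * (c1 + 1) + h * (c1 + 1) ^+ 2.
pose K := (Num.truncn (C / kappa ^+ 2)).+1.
have K0 : 0 < K%:R :> R by [].
have hK : C <= kappa ^+ 2 * K%:R.
  rewrite mulrC -ler_pdivrMr ?exprn_gt0 // ltW //.
  exact: (lt_le_trans (truncnS_gt _)).
(* The first bound pays the factor [2 * K] of [block_increment]; the second is the quarter reserved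
   for arrivals. *)
pose de' := Num.min (de / (2 * K%:R)) (g / 4).
have de'0 : 0 < de'.
  by rewrite lt_min; apply/andP; split; apply: divr_gt0 => //; exact: mulr_gt0.
have [de'1 de'2] : 2 * K%:R * de' <= de /\ de' <= g / 4.
  split; last by rewrite ge_min lexx orbT.
  by rewrite mulrC -ler_pdivlMr ?mulr_gt0 // ge_min lexx.
pose L T := ((#|E| * T) %/ K)%N.
have toinf k M : exists n0, forall n, (n0 <= n)%N -> (M <= k.+1 * L n)%N.
  exists (M * K)%N => n hn; apply: leq_trans (leq_pmull _ (ltn0Sn k)).
  by rewrite leq_divRL // (leq_trans hn) // leq_pmull.
have v1 := vanishing_exists (fun k : 'I_K =>
  vanishing_comp (vanishing_arrivals de'0) (toinf k)).
have v2 := vanishing_exists (fun k : 'I_K =>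
  vanishing_comp (vanishing_visits de'0) (toinf k)).
(* Fewer than [K] mini-slots fall outside the blocks; beyond this threshold the mean number of
   arrivals in [K] mini-slots is at most [g / 2 * (m * T)]. *)
apply: (vanishing_sub (n0 := (Num.truncn (2 * al * K%:R / (g * m))).+1)) (vanishingU v1 v2) _.
  by move=> T; exact: (measurable_rec i T (fun k => k%:R / T%:R < b)).
move=> T hT w /= recb; apply: contrapT => /not_orP[/forallNP h1 /forallNP h2].
have T0 : 0 < T%:R :> R by rewrite ltr0n (leq_trans _ hT).
have sE : forall k, S k w \in E by case: model.
have KL : (K * L T <= #|E| * T)%N by rewrite mulnC leq_trunc_div.
have d1 (k : 'I_K) : `|(arrived (A ^~ w) (k.+1 * L T))%:R - k.+1%:R * (L T)%:R * al|
    <= de' * (k.+1%:R * (L T)%:R).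
  by rewrite -natrM ltW // ltNge; apply/negP/h1.
have d2 (k : 'I_K) e : e \in E -> `|(visits (S ^~ w) e (k.+1 * L T))%:R
    - k.+1%:R * (L T)%:R * (1 / m)| <= de' * (k.+1%:R * (L T)%:R).
  move=> eE; rewrite -natrM ltW // ltNge; apply/negP.
  by have /forallNP/(_ (exist _ e eE)) := h2 k.
have L0 : 0 <= (L T)%:R :> R by [].
have de'L : 2 * K%:R * de' * (L T)%:R <= de * (L T)%:R by rewrite ler_wpM2r.
have harr k : (k < K)%N -> (arrived (A ^~ w) (k.+1 * L T))%:R
    - (arrived (A ^~ w) (k * L T))%:R <= c1 * (L T)%:R :> R.
  move=> kK; have := @block_increment R (fun k => (arrived (A ^~ w) (k * L T))%:R)
    K (L T)%:R al de' L0 (ltW de'0) _ (fun k kK => d1 (Ordinal kK)) k kK.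
  rewrite mul0n /arrived big_ord0 => /(_ erefl); rewrite ler_norml => /andP[_].
  by rewrite /c1; lra.
have hvis k e : (k < K)%N -> e \in E -> c2 * (L T)%:R <=
    (visits (S ^~ w) e (k.+1 * L T))%:R - (visits (S ^~ w) e (k * L T))%:R.
  move=> kK eE; have := @block_increment R (fun k => (visits (S ^~ w) e (k * L T))%:R)
    K (L T)%:R (1 / m) de' L0 (ltW de'0) _ (fun k kK => d2 (Ordinal kK) e eE) k kK.
  rewrite mul0n /visits big_ord0 => /(_ erefl); rewrite ler_norml => /andP[+ _].
  by rewrite /c2; lra.
have := max_weight_received (rule w) sE i c10 (ltW kappa0) cap harr hvis hK KL.
rewrite -/(rec w i T); apply/negP; rewrite -ltNge.
move: recb; rewrite ltr_pdivrMr // => /lt_le_trans; apply.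
(* The last index gives the arrivals over all [K] blocks. *)
have := d1 ord_max; rewrite ler_norml => /andP[+ _].
rewrite -natrM -/K -/h mulrA hkappa => arrge.
have KL1 : (K * L T)%:R <= m * T%:R :> R by rewrite -natrM ler_nat.
have KL2 : m * T%:R - K%:R <= (K * L T)%:R.
  rewrite lerBlDr -natrM -natrD ler_nat [(K * _)%N]mulnC [leqLHS](divn_eq _ K) leq_add2l.
  by rewrite ltnW // ltn_mod.
have hT' : al * K%:R <= g / 2 * (m * T%:R).
  have : 2 * al * K%:R / (g * m) <= T%:R.
    by rewrite ltW // (lt_le_trans (truncnS_gt _)) // ler_nat.
  by rewrite (ler_pdivrMr _ _ (mulr_gt0 g0 mR)) => /arith1.
have e1 : de' * (K * L T)%:R <= g / 4 * (m * T%:R).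
  by apply: ler_pM => //; exact: ltW.
have e2 : g / 4 * (K * L T)%:R <= g / 4 * (m * T%:R).
  by rewrite ler_wpM2l // divr_ge0 // ltW.
have e3 : al * (m * T%:R - K%:R) <= al * (K * L T)%:R by rewrite ler_wpM2l.
by rewrite bE; exact: arith2 arrge hT' e1 e2 e3.
Qed.

End Model.

(** * Matching upper and lower bounds on the broadcast rate *)

Theorem theorem1 (R : realType) (V : finType) (E : {set V * V}) (r : V)
    (lambda : R)
    (d : measure_display) (Omega : measurableType d)
    (P : probability Omega R)
    (A : nat -> Omega -> nat) (S : nat -> Omega -> V * V)
    (U : nat -> Omega -> option nat) :
  (lambda%:E < broadcast_capacity R E r)%E ->
  mini_slot_model P E lambda A S ->
  pi_star E r A S U ->
  broadcast_policy P E r lambda A S U.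
Proof.
move=> /ereal_sup_gt[_ /= [lambda' [d' [Om' [P' [A' [S' [U' [model' bp]]]]]]] <-]].
rewrite lte_fin => ll' model [mU rule].
have cap := capacity_pressure model' bp.1.1 bp.
split; first by split => // w; exact: max_weight_feasible (rule w).
apply/eqP; rewrite eq_le; apply/andP; split.
  (* Upper bound, at the root: it receives no more than what arrives. A value [b] above [lambda]
     would give a sample point with receptions at least [b * T] and arrivals below [b * T]. *)
  apply: (@le_trans _ _ (liminf_in_probability P (fun T w =>
    ((received E r (A ^~ w) (S ^~ w) (U ^~ w) r T)%:R / T%:R)%R))).
    exact: bigmin_le_cond.
  apply: ub_ereal_sup => _ [b /= cb <-]; rewrite lee_fin leNgt; apply/negP => lb.
  have m0 : 0 < #|E|%:R :> R by rewrite ltr0n (edges_gt0 model).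
  have e0 : 0 < (b - lambda) / #|E|%:R by rewrite divr_gt0 // subr_gt0.
  have v1 := vanishing_comp (phi := fun T => (#|E| * T)%N) (vanishing_arrivals model e0) _.
  have mB T : measurable [set w | (received E r (A ^~ w) (S ^~ w) (U ^~ w) r T)%:R / T%:R < b].
    exact: (measurable_rec r model mU r T (fun k => k%:R / T%:R < b)).
  have [|n0] := vanishing_complement (vanishingU (v1 _) (cvg_vanishing mB cb)).
    by move=> k; exists k => n /leq_trans; apply; rewrite leq_pmull // (edges_gt0 model).
  move=> /(_ n0.+1 (leqnSn _)) [w /not_orP[/= /negP + /negP]].
  rewrite -ltNge -leNgt ler_pdivlMr // ltr_norml natrM => /andP[_ h1] h2.
  have h3 : (received E r (A ^~ w) (S ^~ w) (U ^~ w) r n0.+1)%:R <=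
      (arrived (A ^~ w) (#|E| * n0.+1))%:R :> R by rewrite ler_nat received_le_arrived.
  move: h1.
  have -> : (b - lambda) / #|E|%:R * (#|E|%:R * n0.+1%:R) = (b - lambda) * n0.+1%:R.
    by field; rewrite gt_eqF.
  have -> : #|E|%:R * n0.+1%:R * (lambda / #|E|%:R) = lambda * n0.+1%:R.
    by field; rewrite gt_eqF.
  by lra.
(* Lower bound: at every node, each [lambda - e] belongs to the set whose supremum is the limit
   inferior. *)
apply: le_bigmin => [|i _]; first exact: leey.
apply/lee_subgt0Pr => e e0; rewrite -EFinB.
apply: ereal_sup_ubound; exists (lambda - e) => //=.
apply: vanishing_cvg; apply: (max_weight_rate model mU i ll') => //.
by rewrite ltrBlDr ltrDl.
Qed.
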